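(* Let $\mathcal{I}$ be a finite category. Then the series Euler characteristic $\chi_{\sum}(\mathrm{Sd}(\mathcal{I}))$ of the barycentric subdivision of $\mathcal{I}$ can be defined if and only if $\mathcal{I}$ is acyclic, in which case $$\chi_{\sum}(\mathcal{I})=\chi_{\sum}(\mathrm{Sd}(\mathcal{I})).$$
   Context: A small category is acyclic if all its endomorphisms are identities and, whenever there is a morphism $X\to Y$ with $X\neq Y$, there is no morphism $Y\to X$. A finite category has finitely many objects and morphisms. For a natural number $n\ge 0$, $[n]=\{0,1,\dots,n\}$ is the poset with the usual order. For a small category $\mathcal{J}$, $\overline{N_n}(\mathcal{J})$ is the set of non-degenerate chains $x_0\xrightarrow{f_1}x_1\to\cdots\xrightarrow{f_n}x_n$ in $\mathcal{J}$, i.e. functors $[n]\to\mathcal{J}$ for which no $f_i$ is an identity, with $\overline{N_0}(\mathcal{J})=\mathrm{Ob}(\mathcal{J})$. Series Euler characteristic (defined only for finite categories). For a formal power series $f(t)\in\mathbb{Z}[[t]]$, if there is a rational function $g(t)/h(t)\in\mathbb{Q}(t)$ with $f(t)=g(t)/h(t)$ in $\mathbb{Q}((t))$ and $h(-1)\neq0$, set $f|_{t=-1}=g(-1)/h(-1)\in\mathbb{Q}$. For a finite category $\mathcal{I}$, let $f_{\mathcal{I}}(t)=\sum_{n=0}^\infty\#\overline{N_n}(\mathcal{I})\,t^n$ and $\chi_{\sum}(\mathcal{I})=f_{\mathcal{I}}(t)|_{t=-1}$, if this exists. Barycentric subdivision. $\mathrm{Sd}(\mathcal{J})$ is the small category whose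 set of objects is $\coprod_{n\ge0}\overline{N_n}(\mathcal{J})$. An object $X$ of length $q_X$ is regarded as a functor $X:[q_X]\to\mathcal{J}$. The set of morphisms from $X$ to $Y$ is the quotient of the set of order-preserving maps $f:[q_X]\to[q_Y]$ with $Y\circ f=X$ by the equivalence relation generated by: $f\sim g$ if for every $0\le i\le q_X$ the morphism $Y(\min\{f(i),g(i)\}\to\max\{f(i),g(i)\})$ is an identity. Composition is induced by composition of order-preserving maps. *)

(* Defs.v *)
From HB Require Import structures.
From Stdlib Require Import Relations.Relation_Operators.
From mathcomp Require Import all_boot all_order all_algebra.
From mathcomp Require Import generic_quotient.
From mathcomp Require Import finmap boolp classical_sets cardinality.

Set Implicit Arguments.
Unset Strict Implicit.
Unset Printing Implicit Defensive.

Import Order.TTheory GRing.Theory Num.Theory.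

Local Open Scope classical_set_scope.
Local Open Scope quotient_scope.

(* [comp g f] is the composite "g after f". *)
Record category := Category {
  Ob : Type;
  Hom : Ob -> Ob -> Type;
  idm : forall x, Hom x x;
  comp : forall x y z, Hom y z -> Hom x y -> Hom x z;
  comp_idl : forall x y (f : Hom x y), comp (idm y) f = f;
  comp_idr : forall x y (f : Hom x y), comp f (idm x) = f;
  compA : forall x y z w (h : Hom z w) (g : Hom y z) (f : Hom x y),
    comp h (comp g f) = comp (comp h g) f
}.

Arguments Hom {c} _ _.
Arguments idm {c} x.
Arguments comp {c x y z} _ _.

Inductive is_identity (C : category) (x : Ob C) : forall y, Hom x y -> Prop :=
  IsIdentity : is_identity (idm x).

Definition finite_category (C : category) : Prop :=
  finite_set [set: Ob C] /\
  finite_set [set: {x : Ob C & {y : Ob C & Hom x y}}].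

Definition acyclic (C : category) : Prop :=
  (forall (x : Ob C) (f : Hom x x), f = idm x) /\
  (forall x y : Ob C, x <> y -> inhabited (Hom x y) -> ~ inhabited (Hom y x)).

Record functor (C D : category) := Functor {
  fobj :> Ob C -> Ob D;
  fmap : forall x y, Hom x y -> Hom (fobj x) (fobj y);
  fmap_id : forall x, fmap (idm x) = idm (fobj x);
  fmap_comp : forall x y z (g : Hom y z) (f : Hom x y),
    fmap (comp g f) = comp (fmap g) (fmap f)
}.

Arguments fmap {C D} _ {x y} _.

Section FunctorComposition.
Variables (B C D : category) (G : functor C D) (F : functor B C).

Let cobj (x : Ob B) : Ob D := G (F x).
Let cmap x y (f : Hom x y) : Hom (cobj x) (cobj y) := fmap G (fmap F f).

Fact cmap_id x : cmap (idm x) = idm (cobj x).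
Proof. by rewrite /cmap !fmap_id. Qed.

Fact cmap_comp x y z (g : Hom y z) (f : Hom x y) :
  cmap (comp g f) = comp (cmap g) (cmap f).
Proof. by rewrite /cmap !fmap_comp. Qed.

Definition functor_comp : functor B D := Functor cmap_id cmap_comp.
End FunctorComposition.

Section PosetCategory.
Variables (d : Order.disp_t) (T : porderType d).

Let phom (x y : T) : Type := (x <= y)%O.
Let pcomp (x y z : T) (g : phom y z) (f : phom x y) : phom x z :=
  le_trans f g.

Definition poset_category : category :=
  @Category T phom (@lexx _ T) pcomp
    (fun _ _ _ => bool_irrelevance _ _) (fun _ _ _ => bool_irrelevance _ _)
    (fun _ _ _ _ _ _ _ => bool_irrelevance _ _).
End PosetCategory.

Section PosetFunctor.
Variables (d d' : Order.disp_t) (T : porderType d) (T' : porderType d').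
Variable f : {omorphism T -> T'}.

Let pmap (x y : T) (le_xy : (x <= y)%O) : (f x <= f y)%O :=
  omorph_le f le_xy.

Definition poset_functor : functor (poset_category T) (poset_category T') :=
  @Functor (poset_category T) (poset_category T') f pmap
    (fun _ => bool_irrelevance _ _) (fun _ _ _ _ _ => bool_irrelevance _ _).
End PosetFunctor.

Definition ord_category (n : nat) : category := poset_category 'I_n.+1.

(* For [n = 0] the condition is void, and functors from [ord_category 0] to
   [J] are just the objects of [J]. *)
Definition nondegenerate (J : category) (n : nat)
    (X : functor (ord_category n) J) : Prop :=
  forall (i j : 'I_n.+1) (le_ij : (i <= j)%O),
    j = i.+1 :> nat -> ~ is_identity (fmap X (le_ij : @Hom (ord_category n) i j)).

Record nchain (J : category) (n : nat) := NChain {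
  nchain_functor :> functor (ord_category n) J;
  nchain_nondegenerate : nondegenerate nchain_functor
}.

Record sd_ob (J : category) := SdOb {
  sd_length : nat;
  sd_chain :> nchain J sd_length
}.

(* Order-preserving maps [f] with [Y o f = X], an equality of functors. *)
Record sd_map (J : category) (X Y : sd_ob J) := SdMap {
  sd_fun :> {omorphism 'I_(sd_length X).+1 -> 'I_(sd_length Y).+1};
  sd_funE : functor_comp Y (poset_functor sd_fun) = X
}.

Fact le_min_max (d : Order.disp_t) (T : orderType d) (x y : T) :
  (Order.min x y <= Order.max x y)%O.
Proof. by rewrite ge_min le_max lexx. Qed.

Fact omorph_min (d d' : Order.disp_t) (T : orderType d) (T' : orderType d')
    (f : {omorphism T -> T'}) (x y : T) :
  f (Order.min x y) = Order.min (f x) (f y).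
Proof.
by case: (leP x y) => [|/ltW] /(omorph_le f) => [/min_idPl|/min_idPr].
Qed.

Fact omorph_max (d d' : Order.disp_t) (T : orderType d) (T' : orderType d')
    (f : {omorphism T -> T'}) (x y : T) :
  f (Order.max x y) = Order.max (f x) (f y).
Proof.
by case: (leP x y) => [|/ltW] /(omorph_le f) => [/max_idPr|/max_idPl].
Qed.

Definition sd_step (J : category) (X Y : sd_ob J) (f g : sd_map X Y) : Prop :=
  forall i : 'I_(sd_length X).+1,
    is_identity (fmap Y (le_min_max (f i) (g i) :
      @Hom (ord_category _) (Order.min (f i) (g i)) (Order.max (f i) (g i)))).

(* [{classic T}] is [T] with the choice structure [{eq_quot _}] requires. *)
Definition sd_rel (J : category) (X Y : sd_ob J) : rel {classic sd_map X Y} :=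
  fun f g => `[< clos_refl_sym_trans _ (@sd_step J X Y) f g >].

Fact sd_rel_equiv (J : category) (X Y : sd_ob J) :
  equiv_class_of (@sd_rel J X Y).
Proof.
split.
- by move=> f; apply/asboolP/rst_refl.
- by move=> f g; apply/asboolP/asboolP => h; apply: rst_sym.
- by move=> g f h /asboolP fg /asboolP gh; apply/asboolP/(rst_trans _ _ _ g).
Qed.

Canonical sd_equiv (J : category) (X Y : sd_ob J) :
  equiv_rel {classic sd_map X Y} := EquivRelPack (sd_rel_equiv X Y).

Definition sd_hom (J : category) (X Y : sd_ob J) : Type :=
  {eq_quot sd_equiv X Y}.

Definition sd_class (J : category) (X Y : sd_ob J) (f : sd_map X Y) :
  sd_hom X Y := \pi_({eq_quot sd_equiv X Y}) (f : {classic sd_map X Y}).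

Definition sd_repr (J : category) (X Y : sd_ob J) (u : sd_hom X Y) :
  sd_map X Y := repr (u : {eq_quot sd_equiv X Y}).

Lemma sd_reprK (J : category) (X Y : sd_ob J) (u : sd_hom X Y) :
  sd_class (sd_repr u) = u.
Proof. exact: reprK. Qed.

Lemma sd_classP (J : category) (X Y : sd_ob J) (f g : sd_map X Y) :
  sd_class f = sd_class g <-> clos_refl_sym_trans _ (@sd_step J X Y) f g.
Proof.
split=> [/eqmodP /asboolP //|fg]; exact/eqmodP/asboolP.
Qed.

Section SdMaps.
Variable J : category.
Implicit Types X Y Z W : sd_ob J.

Fact functor_ext (C D : category) (o : Ob C -> Ob D)
    (m m' : forall x y, Hom x y -> Hom (o x) (o y)) i i' c c' :
  (forall x y f, m x y f = m' x y f) ->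
  @Functor C D o m i c = @Functor C D o m' i' c'.
Proof.
move=> e; have {}e : m = m'.
  by apply: functional_extensionality_dep => x;
     apply: functional_extensionality_dep => y; apply/funext/e.
by rewrite -e in i' c' *; congr Functor; apply: Prop_irrelevance.
Qed.

Fact sd_map_id_subproof X :
  functor_comp X (poset_functor (idfun : {omorphism _ -> _})) = X.
Proof.
case: (nchain_functor _) => o m i c; apply: functor_ext => x y f /=.
by congr m; apply: bool_irrelevance.
Qed.

Definition sd_map_id X : sd_map X X := SdMap (sd_map_id_subproof X).

Fact sd_map_comp_subproof X Y Z (g : sd_map Y Z) (f : sd_map X Y) :
  functor_comp Z (poset_functor (g \o f : {omorphism _ -> _})) = X.
Proof.
rewrite -[RHS](sd_funE f) -[in RHS](sd_funE g).
apply: functor_ext => x y h /=.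
by congr fmap; apply: bool_irrelevance.
Qed.

Definition sd_map_comp X Y Z (g : sd_map Y Z) (f : sd_map X Y) : sd_map X Z :=
  SdMap (sd_map_comp_subproof g f).

Lemma sd_step_ext X Y (f g : sd_map X Y) :
  (forall i, f i = g i) -> sd_step f g.
Proof.
move=> fg i; set le_fg := le_min_max _ _; move: le_fg.
rewrite fg minxx maxxx => le_gg.
rewrite (bool_irrelevance le_gg (lexx _)).
rewrite (fmap_id Y (g i : Ob (ord_category _))); exact: IsIdentity.
Qed.

Lemma sd_step_compl X Y Z (g : sd_map Y Z) (f f' : sd_map X Y) :
  sd_step f f' -> sd_step (sd_map_comp g f) (sd_map_comp g f').
Proof.
move=> ff' i; have {ff'} := ff' i.
set le1 := le_min_max _ _; set le2 := le_min_max _ _.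
move: le1 le2; rewrite /=.
rewrite -!(omorph_min, omorph_max).
set a := Order.min _ _; set b := Order.max _ _ => le1 le2.
rewrite (bool_irrelevance le2 (omorph_le g le1)).
suff h (Y' : functor (ord_category (sd_length Y)) J) :
  functor_comp Z (poset_functor g) = Y' ->
  is_identity (fmap Y' (le1 : @Hom (ord_category _) a b)) ->
  is_identity (fmap Z (omorph_le g le1 : @Hom (ord_category _) (g a) (g b))).
  exact: h (sd_funE g).
by move=> <-.
Qed.

Lemma sd_step_compr X Y Z (g g' : sd_map Y Z) (f : sd_map X Y) :
  sd_step g g' -> sd_step (sd_map_comp g f) (sd_map_comp g' f).
Proof. by move=> gg' i; apply: gg'. Qed.

Definition sd_comp X Y Z (v : sd_hom Y Z) (u : sd_hom X Y) : sd_hom X Z :=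
  sd_class (sd_map_comp (sd_repr v) (sd_repr u)).

Lemma sd_class_comp X Y Z (g g' : sd_map Y Z) (f f' : sd_map X Y) :
  sd_class g = sd_class g' -> sd_class f = sd_class f' ->
  sd_class (sd_map_comp g f) = sd_class (sd_map_comp g' f').
Proof.
move=> /sd_classP gg' /sd_classP ff'; transitivity (sd_class (sd_map_comp g' f)).
  apply/sd_classP; elim: gg' => {g g'}.
  - by move=> g g' /(sd_step_compr f) h; apply: rst_step.
  - by move=> g; apply: rst_refl.
  - by move=> g g' _; apply: rst_sym.
  - by move=> g1 g2 g3 _ h _; apply: rst_trans.
apply/sd_classP; elim: ff' => {f f'}.
- by move=> f f' /(sd_step_compl g') h; apply: rst_step.
- by move=> f; apply: rst_refl.
- by move=> f f' _; apply: rst_sym.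
- by move=> f1 f2 f3 _ h _; apply: rst_trans.
Qed.

Lemma sd_compE X Y Z (g : sd_map Y Z) (f : sd_map X Y) :
  sd_comp (sd_class g) (sd_class f) = sd_class (sd_map_comp g f).
Proof. by apply: sd_class_comp; apply: sd_reprK. Qed.

Lemma sd_class_ext X Y (f g : sd_map X Y) :
  (forall i, f i = g i) -> sd_class f = sd_class g.
Proof. by move=> fg; apply/sd_classP/rst_step/sd_step_ext. Qed.

Fact sd_comp_idl X Y (u : sd_hom X Y) :
  sd_comp (sd_class (sd_map_id Y)) u = u.
Proof. by rewrite -[u]sd_reprK sd_compE; apply: sd_class_ext. Qed.

Fact sd_comp_idr X Y (u : sd_hom X Y) :
  sd_comp u (sd_class (sd_map_id X)) = u.
Proof. by rewrite -[u]sd_reprK sd_compE; apply: sd_class_ext. Qed.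

Fact sd_compA X Y Z W (w : sd_hom Z W) (v : sd_hom Y Z) (u : sd_hom X Y) :
  sd_comp w (sd_comp v u) = sd_comp (sd_comp w v) u.
Proof.
rewrite -[u]sd_reprK -[v]sd_reprK -[w]sd_reprK !sd_compE.
exact: sd_class_ext.
Qed.

Definition Sd : category :=
  @Category (sd_ob J) (@sd_hom J) (fun X => sd_class (sd_map_id X)) sd_comp
    sd_comp_idl sd_comp_idr sd_compA.

End SdMaps.

Local Open Scope ring_scope.

(* [series_value f q]: the power series [\sum_n f n t^n] equals some [g / h]
   in Q((t)) with [h(-1) <> 0], and [q = g(-1) / h(-1)].  Equality with the
   fraction is spelled out as [f * h = g] in Q[[t]] (Cauchy product), the
   condition [h <> 0] following from [h(-1) <> 0]. *)
Definition series_value (f : nat -> int) (q : rat) : Prop :=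
  exists g h : {poly rat},
    [/\ forall n : nat, \sum_(i < n.+1) (f i)%:~R * h`_(n - i) = g`_n,
        h.[-1] != 0
      & q = g.[-1] / h.[-1]].

(* [fset_set] is only meaningful on finite sets; the sets of chains of a given
   length in a finite category are finite. *)
Definition nchain_series (C : category) (n : nat) : int :=
  #|` fset_set [set: {classic nchain C n}] |%fset%:Z.

(* "The series Euler characteristic of [C] is defined and equal to [q]". *)
Definition series_euler_char (C : category) (q : rat) : Prop :=
  finite_category C /\ series_value (nchain_series C) q.

Lemma series_value_unique (f : nat -> int) (q1 q2 : rat) :
  series_value f q1 -> series_value f q2 -> q1 = q2.
Proof.
move=> [g1 [h1 [fg1 h1n0 ->]]] [g2 [h2 [fg2 h2n0 ->]]].
suff e : g1 * h2 = g2 * h1.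
  apply/eqP; rewrite eqr_div //; apply/eqP.
  by rewrite -!hornerM e.
apply/polyP => n.
have coefF (h g : {poly rat}) :
    (forall n : nat, \sum_(i < n.+1) (f i)%:~R * h`_(n - i) = g`_n) ->
    forall k, (k <= n)%N ->
    ((\poly_(i < n.+1) (f i)%:~R) * h)`_k = g`_k.
  move=> fg k kn; rewrite coefM -fg; apply: eq_bigr => i _.
  by rewrite coef_poly (leq_trans (ltn_ord i)).
pose F : {poly rat} := \poly_(i < n.+1) (f i)%:~R.
transitivity ((F * h1 * h2)`_n).
  rewrite !coefM; apply: eq_bigr => i _.
  by rewrite (coefF _ _ fg1 _ (ltn_ord i)).
rewrite -mulrA [h1 * h2]mulrC mulrA !coefM; apply: eq_bigr => i _.
by rewrite (coefF _ _ fg2) // -ltnS.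
Qed.

Lemma series_euler_char_unique (C : category) (q1 q2 : rat) :
  series_euler_char C q1 -> series_euler_char C q2 -> q1 = q2.
Proof. by move=> [_ h1] [_]; apply: series_value_unique. Qed.

(* Main.v *)
From HB Require Import structures.
From mathcomp Require Import all_boot all_order all_algebra.
From mathcomp Require Import finmap boolp classical_sets cardinality.
Require Import Defs.

Set Implicit Arguments.
Unset Strict Implicit.
Unset Printing Implicit Defensive.

Import Order.TTheory GRing.Theory Num.Theory.
Local Open Scope ring_scope.

(** The series Euler characteristic is only available for finite categories,
    and the objects of [Sd I] are the non-degenerate chains of [I].  If [I] is
    not acyclic, it has non-degenerate chains of every length: iterate a
    non-identity endomorphism or, when every endomorphism is an identity, run
    back and forth along two opposite morphisms between distinct objects
    ([nchain_of_nonacyclic]).  Hence [Sd I] is infinite.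

    If [I] is acyclic, the objects of a non-degenerate chain are pairwise
    distinct ([nchain_obj_inj]).  Three things follow.  Chains have bounded
    length, so both series are polynomials, and evaluating them at [-1] gives
    alternating sums.  A morphism [X -> Y] of [Sd I] is determined by its
    source and target, since it must send each object of [X] to the place where
    that object occurs in [Y] ([sd_thin]); and a chain admitting a morphism to
    a chain of the same length equals it ([sd_map_eq]).  So [Sd I] is the
    finite poset of non-degenerate chains ordered by the subchain relation,
    graded by length.  Finally, the subchains of [Y] correspond to the nonempty
    sets of positions of [Y], so there are ['C(q + 1, k + 1)] of length [k] when
    [Y] has length [q] ([card_faces]).

    The value for [I] is the sum of [(-1)^(length X)] over all chains [X].  In
    the value for [Sd I], group the strict chains [X_0 < ... < X_n] of the poset
    by their top element [X_n = Y], and let [w(Y)] be the alternating count of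
    the group of [Y].  Deleting the top gives [w(Y) = 1 - sum_(X < Y) w(X)].
    The binomial identity [sum_k (-1)^k 'C(q + 1, k + 1) = 1] shows that
    [Y |-> (-1)^(length Y)] satisfies the same recursion, so
    [w(Y) = (-1)^(length Y)] by induction on length ([sum_chains_below]), and
    the two values agree. *)

(** * Alternating counts of chains in a graded finite order *)

Lemma card_tuple_cons (T : finType) n (P : pred (n.+1.-tuple T)) :
  #|P| = (\sum_(x : T) #|[pred t : n.-tuple T | P [tuple of x :: t]]|)%N.
Proof.
under [RHS]eq_bigr do rewrite -sum1_card.
rewrite -sum1_card pair_big_dep /=.
rewrite (reindex (fun p : T * n.-tuple T => [tuple of p.1 :: p.2])) /=.
  by apply: eq_bigl => -[x t].
exists (fun t : n.+1.-tuple T => (thead t, behead_tuple t)) => [[x t]|t] _ /=.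
  by congr (_, _); apply: val_inj.
by apply: val_inj => /=; case/tupleP: t => x t; rewrite theadE.
Qed.

Section ChainCount.
Variables (T : finType) (lt : rel T).

(** Chains are listed downwards here, so that removing the top element [x]
    removes the head of the list; grouping by the top is what makes the
    recursion run over lower sets. *)
Definition chains_below (n : nat) (x : T) : nat :=
  #|[pred t : n.-tuple T | path (fun a b => lt b a) x t]|.

Lemma chains_below0 x : chains_below 0 x = 1%N.
Proof.
by apply: (fintype.eq_card1 (x := [tuple])) => t; rewrite tuple0 !inE eqxx.
Qed.

Lemma chains_belowS n x :
  chains_below n.+1 x = (\sum_(y | lt y x) chains_below n y)%N.
Proof.
rewrite /chains_below card_tuple_cons [RHS]big_mkcond /=.
apply: eq_bigr => y _.
by case: (lt y x); [apply: fintype.eq_card|apply: fintype.eq_card0] => t.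
Qed.

Lemma card_chains n :
  #|[pred t : n.+1.-tuple T | sorted lt t]| = (\sum_x chains_below n x)%N.
Proof.
transitivity #|[pred t : n.+1.-tuple T | sorted (fun a b => lt b a) t]|.
  pose r (t : n.+1.-tuple T) := [tuple of rev t].
  have rK : involutive r by move=> t; apply: val_inj; rewrite /= revK.
  rewrite -!sum1_card (reindex_inj (inv_inj rK)) /=; apply: eq_bigl => t.
  by rewrite !inE /= rev_sorted.
by rewrite card_tuple_cons.
Qed.

Variables (R : comNzRingType) (rk : T -> nat).
Hypothesis rk_lt : forall x y, lt x y -> (rk x < rk y)%N.

Lemma chains_below_eq0 n x : (rk x < n)%N -> chains_below n x = 0%N.
Proof.
elim: n x => // n IHn x xn; rewrite chains_belowS big1 // => y /rk_lt yx.
by apply: IHn; apply: leq_trans yx _.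
Qed.

(** The induction is on the cut-off [n]: the chains with at most [n + 1] elements
    and top [x] are [x] alone and, for each [y] below [x], the chains with at
    most [n] elements and top [y], extended by [x].  The rank of [y] is less
    than [n], so the truncated sums for [y] are already known. *)
Lemma sum_chains_below :
  (forall x, \sum_(y | lt y x) (-1) ^+ rk y = 1 - (-1) ^+ rk x :> R) ->
  forall n x, (rk x < n)%N ->
    \sum_(i < n) (-1) ^+ i * (chains_below i x)%:R = (-1) ^+ rk x :> R.
Proof.
move=> sum_lt; elim=> // n IHn x; rewrite ltnS => xn.
rewrite big_ord_recl expr0 chains_below0 mul1r.
under eq_bigr => i _.
  rewrite [nat_of_ord _]/= chains_belowS exprS mulN1r mulNr natr_sum mulr_sumr.
  over.
rewrite sumrN exchange_big /=.
under eq_bigr => y yx do rewrite IHn ?(leq_trans (rk_lt yx)) //.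
by rewrite sum_lt subKr.
Qed.

Lemma sum_card_chains N :
  (forall x, \sum_(y | lt y x) (-1) ^+ rk y = 1 - (-1) ^+ rk x :> R) ->
  (forall x, (rk x <= N)%N) ->
  \sum_(n < N.+1) (-1) ^+ n * #|[pred t : n.+1.-tuple T | sorted lt t]|%:R =
    \sum_x (-1) ^+ rk x :> R.
Proof.
move=> sum_lt leN.
under eq_bigr do rewrite card_chains natr_sum mulr_sumr.
rewrite exchange_big; apply: eq_bigr => x _ /=.
exact: (@sum_chains_below sum_lt N.+1 x (leN x)).
Qed.
End ChainCount.

Lemma sum_by_rank (R : comNzRingType) (T : finType) (P : pred T)
    (rk : T -> nat) N :
  (forall x, P x -> (rk x <= N)%N) ->
  \sum_(n < N.+1) (-1) ^+ n * #|[pred x | P x & rk x == n]|%:R =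
    \sum_(x | P x) (-1) ^+ rk x :> R.
Proof.
move=> leN.
rewrite [RHS](partition_big (fun x => inord (rk x) : 'I_N.+1) xpredT) //=.
apply: eq_bigr => n _.
rewrite (eq_bigl [pred x | P x & rk x == n]) => [|x]; last first.
  rewrite !inE; case: (boolP (P x)) => //= /leN xN.
  by rewrite -val_eqE /= inordK.
rewrite (eq_bigr (fun=> (-1) ^+ n)) => [|x /andP [_ /eqP ->] //].
by rewrite sumr_const mulr_natr.
Qed.

(** This is the Euler characteristic of a simplex, read off the expansion of
    [(1 - 1)^(n + 1)]. *)
Lemma sum_alt_binomial (R : comNzRingType) n :
  \sum_(i < n.+1) (-1) ^+ i * 'C(n.+1, i.+1)%:R = 1 :> R.
Proof.
have := exprBn (1 : R) 1 n.+1; rewrite subrr expr0n /= big_ord_recl.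
rewrite expr0 !expr1n bin0 !mulr1 mulr1n => /esym/eqP.
rewrite addr_eq0 => /eqP e.
rewrite [RHS]e -sumrN; apply: eq_bigr => i _.
by rewrite !expr1n !mulr1 lift0 exprS mulN1r mulNrn opprK mulr_natr.
Qed.

Lemma series_value_poly (f : nat -> int) N :
  (forall n, (N < n)%N -> f n = 0) ->
  series_value f (\sum_(n < N.+1) (-1) ^+ n * (f n)%:~R).
Proof.
move=> f0; exists (\poly_(n < N.+1) (f n)%:~R), 1; split.
- move=> n; rewrite coef_poly big_ord_recr /= subnn coef1 eqxx mulr1.
  rewrite big1 ?add0r => [|i _]; first by rewrite ltnS; case: leqP => // /f0 ->.
  by rewrite coef1 subn_eq0 leqNgt ltn_ord mulr0.
- by rewrite hornerC oner_neq0.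
- rewrite hornerC divr1 horner_poly; apply: eq_bigr => i _; exact: mulrC.
Qed.

(** * Monotone maps and tuples *)

(** A strictly increasing map climbs at least one unit per step.  Comparing
    with the end points of the target, this bounds the source by the target and
    forces the map to be the identity when they have the same size. *)
Lemma strict_mono_gap m n (f : 'I_m.+1 -> 'I_n.+1) :
  {homo f : i j / (i < j)%N} ->
  forall i j : 'I_m.+1, (i <= j -> f i + (j - i) <= f j)%N.
Proof.
move=> f_lt i [j jm] /=; elim: j jm => [|j IHj] jm ij.
  rewrite sub0n addn0 (_ : i = Ordinal jm) //.
  by apply/val_inj/eqP; rewrite -leqn0.
have [ji|ji] := eqVneq (i : nat) j.+1.
  by rewrite ji subnn addn0 (_ : i = Ordinal jm) //; apply: val_inj.
have {ji} ij : (i <= j)%N by rewrite -ltnS ltn_neqAle ji.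
rewrite subSn // addnS.
by apply: leq_ltn_trans (IHj (ltnW jm) ij) _; apply: f_lt.
Qed.

Lemma sorted_mktuple (S : Type) (e : rel S) n (f : 'I_n -> S) :
  (forall i j : 'I_n, (i < j)%N -> e (f i) (f j)) -> sorted e (map f (enum 'I_n)).
Proof.
move=> f_lt; apply: (homo_sorted (e := relpre val ltn)) => //.
by rewrite -sorted_map val_enum_ord iota_ltn_sorted.
Qed.

Section StrictTuple.
Variables (k q : nat) (t : k.+1.-tuple 'I_q.+1).
Hypothesis t_sorted : sorted ltn (map val t).

Lemma tnth_lt (i j : 'I_k.+1) : (i < j)%N -> (tnth t i < tnth t j)%N.
Proof.
move=> ij; rewrite !(tnth_nth ord0) -!(nth_map ord0 0%N val) ?size_tuple //.
by apply: (sorted_ltn_nth ltn_trans) => //; rewrite inE size_map size_tuple.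
Qed.

Lemma tnth_le (i j : 'I_k.+1) : (i <= j)%O -> (tnth t i <= tnth t j)%O.
Proof.
rewrite le_eqVlt => /orP [/eqP -> //|ij].
by apply: ltW; apply: tnth_lt.
Qed.

Definition strict_tuple_omorph : {omorphism 'I_k.+1 -> 'I_q.+1} :=
  HB.pack (tnth t) (Order.isOrderMorphism.Build _ _ _ _ (tnth t) tnth_le).
End StrictTuple.

(** * Finite types *)

Lemma finite_set_inj (S : Type) (T : finType) (g : S -> T) :
  injective g -> finite_set [set: S].
Proof.
move=> g_inj; apply: (@finite_preimage _ _ [set: T]%classic g).
  exact: in2W.
exact: finite_finset.
Qed.

Lemma card_fset_set_image (S : Type) (T : finType) (P : pred T) (g : S -> T) :
  injective g -> (forall t, P t <-> exists s, g s = t) ->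
  #|` fset_set [set: {classic S}]|%fset = #|P|.
Proof.
move=> g_inj imP; set A := fset_set _.
have inA (x : {classic S}) : x \in A.
  by rewrite in_fset_set ?inE //; apply: (finite_set_inj g_inj).
have h_inj : injective (fun x : A => g (val x)).
  by move=> x y /g_inj/val_inj.
rewrite cardfE -(card_imset _ h_inj); apply: eq_card => t.
apply/imsetP/idP => [[x _ ->]|/imP [s <-]].
  by apply/imP; exists (val x).
by exists (FSetSub (inA s)).
Qed.

Lemma finite_set_finType (S : Type) : finite_set [set: S] ->
  exists (T : finType) (e : T -> S) (r : S -> T), cancel e r /\ cancel r e.
Proof.
move=> finS; pose A := fset_set [set: {classic S}].
have inA (x : {classic S}) : x \in A by rewrite in_fset_set // inE.
by exists A, val, (fun x => FSetSub (inA x)); split=> // x; apply: val_inj.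
Qed.

Lemma finite_set_graded (S : Type) (A : nat -> Type) (f : forall n, A n -> S) N :
  (forall n, finite_set [set: A n]) ->
  (forall s, exists n (a : A n), (n < N)%N /\ f n a = s) ->
  finite_set [set: S].
Proof.
move=> finA surj.
apply: (@sub_finite_set _ _ (\bigcup_(n in `I_N) range (f n))%classic).
  by move=> s _; have [n [a [nN <-]]] := surj s; exists n => //; exists a.
by apply: bigcup_finite => [|n _]; [apply: finite_II|apply: finite_image].
Qed.

Lemma finite_bounded (S : Type) (l : S -> nat) :
  finite_set [set: S] -> exists N, forall s, (l s <= N)%N.
Proof.
move=> /finite_set_finType [T [e [r [_ rK]]]]; exists (\max_t l (e t)) => s.
by rewrite -[s]rK; apply: (leq_bigmax (F := fun t => l (e t))).
Qed.

(** * Equality of functors and of chains *)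

Lemma existT_inj (A : Type) (P : A -> Type) (x : A) (p q : P x) :
  existT P x p = existT P x q -> p = q.
Proof.
move=> e; have := projT2_eq e.
by rewrite (Prop_irrelevance (projT1_eq e) erefl).
Qed.

Definition trivial_endos (C : category) : Prop :=
  forall (x : Ob C) (f : Hom x x), f = idm x.

Definition thin (C : category) : Prop :=
  forall (x y : Ob C) (f g : Hom x y), f = g.

Lemma is_identity_endo (C : category) (x : Ob C) (f : Hom x x) :
  is_identity f -> f = idm x.
Proof.
suff gen (y : Ob C) (g : Hom x y) (e : y = x) :
    is_identity g -> ecast z (Hom x z) e g = idm x.
  exact: (gen _ _ erefl).
by move=> idg; case: idg e => e; rewrite (Prop_irrelevance e erefl).
Qed.

Lemma is_identity_obj (C : category) (x y : Ob C) (f : Hom x y) :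
  is_identity f -> x = y.
Proof. by case. Qed.

Lemma is_identity_eq_obj (C : category) (x y : Ob C) (f : Hom x y) :
  trivial_endos C -> x = y -> is_identity f.
Proof.
move=> trC e; case: y / e in f *; rewrite (trC _ f); exact: IsIdentity.
Qed.

(** Packing each image morphism with its end points avoids transporting
    morphisms along equalities of objects. *)
Lemma functor_eq (C D : category) (F G : functor C D) :
  (forall x y (f : Hom x y),
     existT (fun a => {b : Ob D & Hom a b}) (F x) (existT _ (F y) (fmap F f)) =
     existT _ (G x) (existT _ (G y) (fmap G f))) -> F = G.
Proof.
case: F => o m i c; case: G => o' m' i' c' /= e.
have oE : o = o' by apply/funext => x; have [] := e _ _ (idm x).
case: _ / oE in m' i' c' e *; apply: functor_ext => x y f.
exact: existT_inj (existT_inj (e _ _ f)).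
Qed.

Lemma functor_thin_eq (C D : category) (F G : functor C D) :
  thin D -> (forall x, F x = G x) -> F = G.
Proof.
move=> thD; case: F => o m i c; case: G => o' m' i' c' /= /funext oE.
by case: _ / oE in m' i' c' *; apply: functor_ext => x y f; apply: thD.
Qed.

Lemma thin_functor (C D : category) (o : Ob C -> Ob D) :
  thin D -> (forall x y, inhabited (Hom x y) -> inhabited (Hom (o x) (o y))) ->
  exists F : functor C D, forall x, F x = o x.
Proof.
move=> thD oH; have m x y (f : Hom x y) : Hom (o x) (o y).
  have /cid [g _] // : exists g : Hom (o x) (o y), True.
  by have [g] := oH x y (inhabits f); exists g.
by exists (@Functor C D o m (fun=> thD _ _ _ _) (fun _ _ _ _ _ => thD _ _ _ _)).
Qed.

Lemma nchain_eq (J : category) n (X Y : nchain J n) :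
  nchain_functor X = nchain_functor Y -> X = Y.
Proof.
case: X Y => X nX [Y nY] /= e; case: _ / e in nY *.
by congr NChain; apply: Prop_irrelevance.
Qed.

Lemma sd_ob_eq (J : category) n (X Y : nchain J n) : SdOb X = SdOb Y -> X = Y.
Proof.
pose pack (Z : sd_ob J) := existT (nchain J) (sd_length Z) (sd_chain Z).
by move=> e; apply: existT_inj (congr1 pack e).
Qed.

Lemma finite_nchain (J : category) n :
  finite_category J -> finite_set [set: nchain J n].
Proof.
move=> [_ /finite_set_finType [M [e [r [eK rK]]]]].
(* A chain is encoded by the table of its morphisms [X i -> X j], [i <= j]. *)
pose code (X : nchain J n) : {ffun 'I_n.+1 * 'I_n.+1 -> option M} :=
  [ffun p => if boolP (p.1 <= p.2)%O is AltTrue le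
    then Some (r (existT _ (X p.1) (existT _ (X p.2)
                 (fmap X (le : @Hom (ord_category n) p.1 p.2))))) else None].
apply: (@finite_set_inj _ _ code) => X Y /ffunP XY.
apply/nchain_eq/functor_eq => x y f.
have := XY (x, y); rewrite !ffunE /=.
case: {-}_ / boolP => [le|]; last by rewrite f.
by rewrite (bool_irrelevance le f) => -[] /(can_inj rK).
Qed.

(** * Chains of every length in a category that is not acyclic *)

Section EndoChain.
Variables (J : category) (x : Ob J) (f : Hom x x).

Fixpoint endo_pow k : Hom x x :=
  if k is k'.+1 then comp f (endo_pow k') else idm x.

Lemma endo_powD a b : endo_pow (a + b) = comp (endo_pow a) (endo_pow b).
Proof. by elim: a => [|a IHa] /=; rewrite ?comp_idl // IHa compA. Qed.

Let emap n (i j : Ob (ord_category n)) (_ : Hom i j) : Hom x x :=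
  endo_pow ((j : 'I_n.+1) - (i : 'I_n.+1)).

Fact endo_functor_id n (i : Ob (ord_category n)) : emap (idm i) = idm x.
Proof. by rewrite /emap subnn. Qed.

Fact endo_functor_comp n (i j k : Ob (ord_category n))
    (b : Hom j k) (a : Hom i j) :
  emap (comp b a) = comp (emap b) (emap a).
Proof. by rewrite /emap -endo_powD addnBA // subnK. Qed.

Definition endo_functor n : functor (ord_category n) J :=
  @Functor (ord_category n) J (fun=> x) (@emap n) (@endo_functor_id n)
    (@endo_functor_comp n).

Lemma endo_functor_nondegenerate n :
  f <> idm x -> nondegenerate (endo_functor n).
Proof.
move=> fN i j le_ij ji /is_identity_endo.
by rewrite /= /emap ji subSnn /= comp_idr.
Qed.
End EndoChain.

(** When the two composites are identities, [x] and [y] span a copy of the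
    two-object groupoid with one arrow between any two objects, and any
    sequence of objects in it extends uniquely to a functor. *)
Section ZigzagChain.
Variables (J : category) (x y : Ob J) (f : Hom x y) (g : Hom y x).
Hypotheses (gf : comp g f = idm x) (fg : comp f g = idm y).

Let pt (b : bool) : Ob J := if b then y else x.
Let arr (b c : bool) : Hom (pt b) (pt c) :=
  match b, c with
  | false, false => idm x
  | false, true => f
  | true, false => g
  | true, true => idm y
  end.

Fact zigzag_arr_comp a b c : arr a c = comp (arr b c) (arr a b).
Proof. by case: a; case: b; case: c; rewrite /= ?comp_idl ?comp_idr ?gf ?fg. Qed.

Fact zigzag_arr_id a : arr a a = idm (pt a). Proof. by case: a. Qed.

Definition zigzag_functor n : functor (ord_category n) J :=
  @Functor (ord_category n) J (fun i => pt (odd (i : 'I_n.+1)))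
    (fun i j _ => arr (odd (i : 'I_n.+1)) (odd (j : 'I_n.+1)))
    (fun i => zigzag_arr_id _) (fun i j k _ _ => zigzag_arr_comp _ _ _).

Lemma zigzag_nondegenerate n : x <> y -> nondegenerate (zigzag_functor n).
Proof.
move=> xy i j le_ij ji /is_identity_obj /=; rewrite ji /=.
by case: odd => /= [/esym|].
Qed.
End ZigzagChain.

Lemma nchain_of_nonacyclic (J : category) n :
  ~ acyclic J -> inhabited (nchain J n).
Proof.
move=> nacJ; have [trJ|] := pselect (trivial_endos J); last first.
  move=> /existsNP [x /existsNP [f fN]].
  by constructor; exact: NChain (endo_functor_nondegenerate (n := n) fN).
have [noloop|] := pselect (forall x y : Ob J,
    x <> y -> inhabited (Hom x y) -> ~ inhabited (Hom y x)).
  by case: nacJ.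
move=> /existsNP [x /existsNP [y]].
move=> /not_implyP [xy /not_implyP [[f] /contrapT [g]]].
constructor; exact: NChain (zigzag_nondegenerate
  (gf := trJ _ (comp g f)) (fg := trJ _ (comp f g)) (n := n) xy).
Qed.

Lemma acyclic_of_finite_sd (J : category) :
  finite_set [set: sd_ob J] -> acyclic J.
Proof.
move=> /(finite_bounded (@sd_length J)) [N leN]; apply: contrapT => nacJ.
have [X] := nchain_of_nonacyclic N.+1 nacJ.
by have := leN (SdOb X); rewrite ltnn.
Qed.

(** * The subdivision of an acyclic category is a graded poset *)

Lemma sd_hom_inhabited (J : category) (X Y : sd_ob J) :
  @inhabited (@Hom (Sd J) X Y) <-> inhabited (sd_map X Y).
Proof.
by split=> [[u]|[f]]; constructor; [apply: sd_repr u|apply: sd_class f].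
Qed.

Lemma sd_map_obj (J : category) (X Y : sd_ob J) (f : sd_map X Y)
    (i : 'I_(sd_length X).+1) : Y (f i) = X i.
Proof.
exact: (congr1 (fun F : functor (ord_category _) J => F i) (sd_funE f)).
Qed.

Section Acyclic.
Variable J : category.
Hypothesis acJ : acyclic J.

(** The step out of [X i] leads to a different object, since only identities
    are endomorphisms; if the chain came back to [X i] later, there would be a
    morphism in the opposite direction. *)
Lemma nchain_obj_neq n (X : nchain J n) (i j : 'I_n.+1) :
  (i < j)%N -> X i <> X j.
Proof.
move=> ij Xij.
have i1n : (i.+1 < n.+1)%N by apply: leq_trans (ltn_ord j).
pose i1 : 'I_n.+1 := Ordinal i1n.
have le_i1 : (i <= i1)%O by rewrite leEord /=.
have le_1j : (i1 <= j)%O by rewrite leEord.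
pose step := fmap X (le_i1 : @Hom (ord_category n) i i1).
have neq : X i <> X i1.
  by move=> /(is_identity_eq_obj step acJ.1); exact: nchain_nondegenerate.
apply: (acJ.2 _ _ neq); first exact: inhabits step.
rewrite Xij; exact: inhabits (fmap X (le_1j : @Hom (ord_category n) i1 j)).
Qed.

Lemma nchain_obj_inj n (X : nchain J n) :
  injective (fun i : 'I_n.+1 => X i : Ob J).
Proof.
move=> i j Xij; apply: val_inj; apply/eqP; case: ltngtP => //= h.
  by case: (nchain_obj_neq h Xij).
by case: (nchain_obj_neq h (esym Xij)).
Qed.

Lemma sd_thin : thin (Sd J).
Proof.
move=> X Y u v; rewrite -[u]sd_reprK -[v]sd_reprK; apply: sd_class_ext => i.
by apply: (@nchain_obj_inj _ Y); rewrite !sd_map_obj.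
Qed.

Lemma sd_map_lt (X Y : sd_ob J) (f : sd_map X Y) :
  {homo f : i j / (i < j)%N}.
Proof.
move=> i j ij; rewrite ltn_neqAle; apply/andP; split; last first.
  exact: (omorph_le f (ltnW ij)).
apply/eqP => /val_inj fij; case: (nchain_obj_neq (X := X) ij).
by rewrite -!(sd_map_obj f) fij.
Qed.

Lemma sd_map_length (X Y : sd_ob J) (f : sd_map X Y) :
  (sd_length X <= sd_length Y)%N.
Proof.
have := strict_mono_gap (@sd_map_lt _ _ f)
  (leq0n _ : ((ord0 : 'I_(sd_length X).+1) <= (ord_max : 'I__))%N).
rewrite subn0 => gap; rewrite -ltnS; apply: leq_ltn_trans (ltn_ord (f ord_max)).
by apply: leq_trans gap; rewrite leq_addl.
Qed.

Lemma sd_map_eq (X Y : sd_ob J) (f : sd_map X Y) :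
  sd_length X = sd_length Y -> X = Y.
Proof.
have f_gap := strict_mono_gap (@sd_map_lt _ _ f).
case: f f_gap => f fE /= f_gap.
case: X Y f fE f_gap => n X [n' Y] /= f fE f_gap nE.
case: n' / nE in Y f fE f_gap *.
have f_id i : f i = i.
  apply: val_inj; apply/eqP; rewrite eqn_leq.
  have := f_gap ord0 i (leq0n _); have := f_gap i ord_max (leq_ord i).
  rewrite /= subn0 => le_max ge_0; apply/andP; split.
    rewrite -(leq_add2r (n - i)) subnKC ?leq_ord //.
    exact: leq_trans le_max (leq_ord _).
  by apply: leq_trans ge_0; rewrite leq_addl.
congr SdOb; apply: nchain_eq; rewrite -fE.
apply: functor_eq => i j le_ij /=.
move: (omorph_le _ _); rewrite !f_id => le_ij'.
by rewrite (bool_irrelevance le_ij' le_ij).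
Qed.

Lemma acyclic_sd : acyclic (Sd J).
Proof.
split=> [X u|X Y XY]; first exact: sd_thin.
move=> /sd_hom_inhabited [f] /sd_hom_inhabited [g]; apply: XY.
apply: (sd_map_eq f); apply/eqP.
by rewrite eqn_leq (sd_map_length f) (sd_map_length g).
Qed.

Lemma finite_sd_ob : finite_category J -> finite_set [set: sd_ob J].
Proof.
move=> finJ; have [M [e [r [eK rK]]]] := finite_set_finType finJ.1.
apply: (finite_set_graded (N := #|M|) (f := @SdOb J)).
  by move=> n; apply: finite_nchain.
(* A chain of length [n] passes through [n + 1] distinct objects. *)
move=> [n X]; exists n, X; split=> //; rewrite -[n.+1]card_ord.
apply: (leq_card (fun i : 'I_n.+1 => r (X i))) => i j /(can_inj rK).
exact: nchain_obj_inj.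
Qed.

(** * Subchains *)

Section Face.
Variables (Y : sd_ob J) (k : nat) (t : k.+1.-tuple 'I_(sd_length Y).+1).
Hypothesis t_sorted : sorted ltn (map val t).

Let F := functor_comp Y (poset_functor (strict_tuple_omorph t_sorted)).

Lemma face_nondegenerate : nondegenerate F.
Proof.
move=> i j le_ij ji /is_identity_obj.
by apply: nchain_obj_neq; apply: tnth_lt; rewrite // ji.
Qed.

Definition face : sd_ob J := SdOb (NChain face_nondegenerate).

Definition face_map : sd_map face Y :=
  @SdMap _ face Y (strict_tuple_omorph t_sorted) erefl.
End Face.

Lemma sd_map_face (X Y : sd_ob J) (f : sd_map X Y) :
  exists (t : (sd_length X).+1.-tuple 'I_(sd_length Y).+1)
         (ts : sorted ltn (map val t)), X = face ts.
Proof.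
pose t := [tuple f i | i < (sd_length X).+1].
have ts : sorted ltn (map val t).
  rewrite -map_comp; apply: sorted_mktuple => i j; exact: sd_map_lt.
have tE a : tnth t a = f a by rewrite tnth_mktuple.
exists t, ts; case: X f t ts tE => n X f t ts tE.
rewrite /face; congr SdOb; apply: nchain_eq => /=.
rewrite -[LHS](sd_funE f); apply: functor_eq => i j le_ij /=.
move: (omorph_le _ _) => le1; move: (omorph_le _ _).
rewrite /= !tE => le2.
by rewrite (bool_irrelevance le1 le2).
Qed.
End Acyclic.

(** * Counting chains of an acyclic category and of its subdivision *)

(** The chains of [J] are replaced by the elements of a finite type [T] in
    bijection with them, so that they can be counted and summed over. *)
Section SdPoset.
Variables (J : category) (acJ : acyclic J).
Variables (T : finType) (e : T -> sd_ob J) (r : sd_ob J -> T).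
Hypotheses (eK : cancel e r) (rK : cancel r e).

Definition sd_le (x y : T) := `[< inhabited (sd_map (e x) (e y)) >].
Definition sd_lt (x y : T) := (x != y) && sd_le x y.

Lemma sd_le_rank x y : sd_le x y -> (sd_length (e x) <= sd_length (e y))%N.
Proof. by move=> /asboolP [f]; exact: sd_map_length f. Qed.

Lemma sd_lt_rank x y : sd_lt x y -> (sd_length (e x) < sd_length (e y))%N.
Proof.
move=> /andP [xy le_xy]; rewrite ltn_neqAle sd_le_rank // andbT.
apply: contraNneq xy => len_xy; case/asboolP: le_xy => f.
by rewrite -[x]eK (sd_map_eq acJ f len_xy) eK.
Qed.

Lemma sd_lt_trans : transitive sd_lt.
Proof.
move=> y x z xy yz; apply/andP; split.
  apply: contraTneq (ltn_trans (sd_lt_rank xy) (sd_lt_rank yz)) => ->.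
  by rewrite ltnn.
case/andP: xy => _ /asboolP [f]; case/andP: yz => _ /asboolP [g].
by apply/asboolP; constructor; exact: sd_map_comp g f.
Qed.

Lemma card_faces y k :
  #|[pred x | sd_le x y & sd_length (e x) == k]| =
    'C((sd_length (e y)).+1, k.+1).
Proof.
rewrite -card_ltn_sorted_tuples.
pose P (t : k.+1.-tuple 'I_(sd_length (e y)).+1) := sorted ltn (map val t).
pose g (s : {t | P t}) := r (face acJ (valP s)).
have g_inj : injective g.
  move=> s s' /(can_inj rK)/sd_ob_eq/(congr1 (@nchain_functor _ _)) ss'.
  apply/val_inj/eq_from_tnth => i; apply: (@nchain_obj_inj _ acJ _ (e y)).
  exact: (congr1 (fun F : functor (ord_category k) J => F i) ss').
transitivity #|{: {t | P t}}|; last first.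
  by rewrite card_sig; apply: eq_card => t; rewrite !inE.
rewrite -(card_imset _ g_inj); apply: eq_card => x; apply/idP/imsetP.
  move=> /andP [/asboolP [f] /eqP xk].
  have [t [ts xE]] := sd_map_face acJ f.
  case: k / xk in P g g_inj *.
  exists (Sub t ts) => //; apply: (canRL eK); apply: etrans xE _.
  by congr face; apply: bool_irrelevance.
move=> [s _ ->]; rewrite inE /g rK eqxx andbT.
by apply/asboolP; rewrite rK; constructor; exact: face_map.
Qed.

Lemma sum_sd_lt y :
  \sum_(x | sd_lt x y) (-1) ^+ sd_length (e x) =
    1 - (-1) ^+ sd_length (e y) :> rat.
Proof.
have le_yy : sd_le y y by apply/asboolP; constructor; exact: sd_map_id.
apply/(canRL (addrK _)); rewrite addrC.
transitivity (\sum_(x | sd_le x y) (-1) ^+ sd_length (e x) : rat).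
  rewrite [RHS](bigD1 y) //=; congr (_ + _).
  by apply: eq_bigl => x; rewrite andbC.
rewrite -(@sum_by_rank _ _ _ _ (sd_length (e y))) => [|x]; last first.
  exact: sd_le_rank.
by under eq_bigr do rewrite card_faces; apply: sum_alt_binomial.
Qed.

Lemma nchain_series_rank n :
  nchain_series J n = #|[pred x | sd_length (e x) == n]|.
Proof.
congr Posz.
apply: (@card_fset_set_image _ _ _ (fun X : nchain J n => r (SdOb X))).
  by move=> X Y /(can_inj rK)/sd_ob_eq.
move=> x /=; split=> [/eqP|[X <-]]; last by rewrite rK.
by case xE: (e x) => [m X] /= mn; case: n / mn; exists X; rewrite -xE eK.
Qed.

(** As [Sd J] is thin, a chain in it is given by its objects alone; these
    increase strictly because [Sd J] is itself acyclic. *)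
Lemma nchain_series_sd n :
  nchain_series (Sd J) n = #|[pred t : n.+1.-tuple T | sorted sd_lt t]|.
Proof.
pose g (X : nchain (Sd J) n) := [tuple r (X i) | i < n.+1].
congr Posz; apply: (@card_fset_set_image _ _ _ g).
  move=> X Y XY; apply/nchain_eq/(functor_thin_eq (sd_thin acJ)) => i.
  apply: (can_inj rK); have := congr1 (fun t => tnth t i) XY.
  by rewrite !tnth_mktuple.
move=> t /=; split=> [ts|[X <-]].
  have t_lt (i j : 'I_n.+1) : (i < j)%N -> sd_lt (tnth t i) (tnth t j).
    move=> ij; rewrite !(tnth_nth (thead t)).
    by apply: (sorted_ltn_nth sd_lt_trans) => //; rewrite inE size_tuple.
  have [F FE] : exists F : functor (ord_category n) (Sd J),
      forall i, F i = e (tnth t i).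
    apply: (thin_functor (sd_thin acJ)) => i j [ij]; apply/sd_hom_inhabited.
    move: (ij : (i <= j)%N); rewrite leq_eqVlt => /orP [/eqP/val_inj ->|].
      constructor; exact: sd_map_id.
    by move=> /t_lt/andP [_ /asboolP].
  have Fn : nondegenerate F.
    move=> i j le_ij ji /is_identity_obj; rewrite !FE => /(can_inj eK) ij.
    by have := t_lt i j; rewrite ji ltnSn ij /sd_lt eqxx => /(_ isT).
  exists (NChain Fn); apply: eq_from_tnth => i.
  by rewrite tnth_mktuple /= FE eK.
apply: sorted_mktuple => i j ij; apply/andP; split.
  apply/eqP => /(can_inj rK).
  by apply: (nchain_obj_neq (acyclic_sd acJ) (X := X) ij).
apply/asboolP; rewrite !rK; apply/sd_hom_inhabited; constructor.
exact: (fmap X (ltnW ij : @Hom (ord_category n) i j)).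
Qed.

Lemma finite_category_sd : finite_category (Sd J).
Proof.
split; first exact: (finite_set_inj (can_inj rK)).
apply: (@finite_set_inj _ (T * T)%type
          (fun a => (r (projT1 a), r (projT1 (projT2 a))))).
move=> [X [Y u]] [X' [Y' u']] /= [/(can_inj rK) XX /(can_inj rK) YY].
case: _ / XX in u' *; case: _ / YY in u' *.
by rewrite (sd_thin acJ u u').
Qed.
End SdPoset.

Lemma series_euler_char_sd (J : category) : finite_category J -> acyclic J ->
  exists q : rat, series_euler_char J q /\ series_euler_char (Sd J) q.
Proof.
move=> finJ acJ; have finO := finite_sd_ob acJ finJ.
have [N leN] := finite_bounded (@sd_length J) finO.
have [T [e [r [eK rK]]]] := finite_set_finType finO.
pose rk x := sd_length (e x).
exists (\sum_x (-1) ^+ rk x); split; split=> //.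
- rewrite -(@sum_by_rank _ _ xpredT _ N) => [|x _]; last exact: leN.
  under eq_bigr => n _ do rewrite pmulrn -(nchain_series_rank eK rK).
  apply: series_value_poly => n Nn; rewrite (nchain_series_rank eK rK).
  rewrite fintype.eq_card0 // => x; rewrite !inE; apply/negbTE.
  by rewrite ltn_eqF // (leq_ltn_trans (leN _)).
- exact (finite_category_sd acJ rK).
have rk_lt x y : sd_lt e x y -> (rk x < rk y)%N.
  by exact (sd_lt_rank acJ eK (x := x) (y := y)).
rewrite -(sum_card_chains rk_lt (sum_sd_lt acJ eK rK) (N := N)) => [|x].
  under eq_bigr => n _ do rewrite pmulrn -(nchain_series_sd acJ eK rK).
  apply: series_value_poly => n Nn; rewrite (nchain_series_sd acJ eK rK).
  rewrite card_chains big1 // => x _.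
  by apply: (chains_below_eq0 rk_lt); apply: leq_ltn_trans Nn; apply: leN.
exact: leN.
Qed.

Theorem proposition3p8 (I : category) (finI : finite_category I) :
  ((exists q : rat, series_euler_char (Sd I) q) <-> acyclic I) /\
  (acyclic I ->
     exists q : rat, series_euler_char I q /\ series_euler_char (Sd I) q).
Proof.
have sdI := series_euler_char_sd finI.
split=> //; split; last by move=> /sdI [q [_ hq]]; exists q.
by move=> [q [[finO _] _]]; apply: acyclic_of_finite_sd.
Qed.
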